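(* Let $S$ be an arbitrary non-empty set, and let $\mathfrak{F}(S)$ be the set of all functions $S\to[0,1]$ with the operation $(f\circ g)(s)=\sup_{x\in S}\min(f(x),g(s))$ for $f,g\in\mathfrak{F}(S)$, $s\in S$. Then the semigroup $(\mathfrak{F}(S);\circ)$ is a right regular band. Moreover, letting $\eta$ denote the least semilattice congruence on $(\mathfrak{F}(S);\circ)$, the $\eta$-classes of $\mathfrak{F}(S)$ are right zero semigroups, and two elements $f,g\in\mathfrak{F}(S)$ are in the same $\eta$-class if and only if $\sup(f)=\sup(g)$.
   Context: A fuzzy subset of a non-empty set $S$ is a function $f:S\to[0,1]$; $\mathfrak{F}(S)$ is the set of all of them, and $\sup(f)=\sup_{x\in S}f(x)$. A band is a semigroup in which every element $e$ satisfies $e^2=e$; a right regular band is a band satisfying the identity $axa=xa$. A semilattice is a commutative band. A right zero semigroup is a semigroup satisfying the identity $ab=b$. A congruence $\alpha$ on a semigroup $A$ is a semilattice congruence if $A/\alpha$ is a semilattice; every semigroup has a least (with respect to inclusion) semilattice congruence, denoted $\eta$. *)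

(* Defs.v *)
From HB Require Import structures.
From mathcomp Require Import all_boot all_order all_algebra.
From mathcomp Require Import boolp classical_sets reals.
From mathcomp Require Import interval_inference.

Set Implicit Arguments.
Unset Strict Implicit.
Unset Printing Implicit Defensive.
Import Order.TTheory GRing.Theory Num.Theory.
Local Open Scope classical_set_scope.
Local Open Scope ring_scope.

Section Semigroups.
Variables (A : Type) (op : A -> A -> A).

Definition band : Prop := associative op /\ idempotent_op op.

Definition right_regular_band : Prop :=
  band /\ forall a x : A, op (op a x) a = op x a.

Definition semilattice : Prop := band /\ commutative op.

Definition right_zero_semigroup : Prop :=
  associative op /\ forall a b : A, op a b = b.

Definition op_closed (C : set A) : Prop :=
  forall a b, C a -> C b -> C (op a b).

Definition sub_op (C : set A) (hC : op_closed C) (a b : {x | C x}) : {x | C x} :=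
  exist _ (op (sval a) (sval b)) (hC _ _ (svalP a) (svalP b)).

Record congruence (alpha : A -> A -> Prop) : Prop := Congruence {
  congruence_refl : forall a, alpha a a;
  congruence_sym : forall a b, alpha a b -> alpha b a;
  congruence_trans : forall a b c, alpha a b -> alpha b c -> alpha a c;
  congruence_op : forall a b c d,
    alpha a b -> alpha c d -> alpha (op a c) (op b d) }.

End Semigroups.

Section Quotient.
Variables (A : Type) (op : A -> A -> A) (alpha : A -> A -> Prop).

(* For an equivalence relation, the class of [a] is the set [alpha a]. *)
Definition is_class (C : set A) : Prop := exists a, C = alpha a.

Definition quot : Type := {C : set A | is_class C}.

Definition quot_class (a : A) : quot :=
  exist _ (alpha a) (ex_intro _ a erefl).

Definition quot_repr (C : quot) : A := sval (cid (svalP C)).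

(* The choice of representatives is immaterial when [alpha] is a congruence,
   see [quot_opE]. *)
Definition quot_op (C D : quot) : quot :=
  quot_class (op (quot_repr C) (quot_repr D)).

Definition semilattice_congruence : Prop :=
  congruence op alpha /\ semilattice quot_op.

Lemma quot_reprK (C : quot) : quot_class (quot_repr C) = C.
Proof.
apply: eq_sig_hprop => [D p q|/=]; first exact: Prop_irrelevance.
by rewrite /quot_repr; case: cid.
Qed.

Lemma quot_classP (a b : A) : congruence op alpha ->
  quot_class a = quot_class b <-> alpha a b.
Proof.
move=> cg; split=> [[] /(congr1 (fun C => C b)) -> |ab].
  exact: congruence_refl cg b.
apply: eq_sig_hprop => [D p q|/=]; first exact: Prop_irrelevance.
apply/funext => c; apply/propext; split.
  exact: (congruence_trans cg) (congruence_sym cg ab).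
exact: (congruence_trans cg) ab.
Qed.

Lemma quot_opE (a b : A) : congruence op alpha ->
  quot_op (quot_class a) (quot_class b) = quot_class (op a b).
Proof.
move=> cg; apply/(quot_classP _ _ cg)/(congruence_op cg);
  by apply/(quot_classP _ _ cg); rewrite quot_reprK.
Qed.

Lemma semilattice_congruenceP : congruence op alpha ->
  semilattice quot_op <->
  [/\ forall a b c, alpha (op a (op b c)) (op (op a b) c),
      forall a, alpha (op a a) a & forall a b, alpha (op a b) (op b a)].
Proof.
move=> cg; split=> [[[aA aI] aC]|[aA aI aC]].
- have E u v := esym (quot_opE u v cg).
  split=> [a b c|a|a b]; apply/(quot_classP _ _ cg).
  + by rewrite 4!E aA.
  + by rewrite E aI.
  + by rewrite 2!E aC.
- split; first split.
  + move=> C D E; rewrite -(quot_reprK C) -(quot_reprK D) -(quot_reprK E).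
    by rewrite !quot_opE //; apply/(quot_classP _ _ cg).
  + move=> C; rewrite -(quot_reprK C).
    by rewrite !quot_opE //; apply/(quot_classP _ _ cg).
  + move=> C D; rewrite -(quot_reprK C) -(quot_reprK D).
    by rewrite !quot_opE //; apply/(quot_classP _ _ cg).
Qed.

End Quotient.

Definition least_semilattice_congruence (A : Type) (op : A -> A -> A)
    (eta : A -> A -> Prop) : Prop :=
  semilattice_congruence op eta /\
  forall alpha, semilattice_congruence op alpha ->
    forall a b, eta a b -> alpha a b.

Lemma least_semilattice_congruence_exists (A : Type) (op : A -> A -> A) :
  exists eta, least_semilattice_congruence op eta.
Proof.
pose eta a b := forall alpha, semilattice_congruence op alpha -> alpha a b.
have cg : congruence op eta.
  split.
  - by move=> a al [cg _]; exact: congruence_refl cg a.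
  - by move=> a b ab al [cg sl]; apply: (congruence_sym cg); exact: ab.
  - move=> a b c ab bc al [cg sl].
    by apply: (congruence_trans cg); [exact: ab | exact: bc].
  - move=> a b c d ab cd al [cg sl].
    by apply: (congruence_op cg); [exact: ab | exact: cd].
exists eta; split; last by move=> al sl a b; exact.
split=> //; apply/(semilattice_congruenceP cg).
by split=> [a b c|a|a b] al [cg' /(semilattice_congruenceP cg')[]].
Qed.

Lemma least_semilattice_congruence_unique (A : Type) (op : A -> A -> A)
    (eta eta' : A -> A -> Prop) :
  least_semilattice_congruence op eta ->
  least_semilattice_congruence op eta' -> eta = eta'.
Proof.
move=> [s l] [s' l']; apply/funext => a; apply/funext => b.
by apply/propext; split; [exact: l | exact: l'].
Qed.

Definition fuzzy (R : realType) (S : Type) : Type := S -> {i01 R}.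

Definition fuzzy_sup (R : realType) (S : Type) (f : fuzzy R S) : R :=
  sup [set (f x)%:num | x in [set: S]].

Definition fuzzy_comp_val (R : realType) (S : Type) (f g : fuzzy R S) (s : S)
  : R := sup [set Num.min (f x)%:num (g s)%:num | x in [set: S]].

Lemma fuzzy_comp_val_ge0 (R : realType) (S : Type) (f g : fuzzy R S) (s : S) :
  0 <= fuzzy_comp_val f g s.
Proof.
have h : 0 <= Num.min (f s)%:num (g s)%:num :> R by rewrite le_min !ge0.
apply: (le_trans h); apply: ub_le_sup; last by exists s.
by exists 1 => _ [x _ <-]; rewrite ge_min le1.
Qed.

Lemma fuzzy_comp_val_le1 (R : realType) (S : Type) (f g : fuzzy R S) (s : S) :
  fuzzy_comp_val f g s <= 1.
Proof.
apply: ge_sup; first by exists (Num.min (f s)%:num (g s)%:num), s.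
by move=> _ [x _ <-]; rewrite ge_min le1.
Qed.

Definition fuzzy_comp (R : realType) (S : Type) (f g : fuzzy R S)
  : fuzzy R S :=
  fun s => Itv01 (fuzzy_comp_val_ge0 f g s) (fuzzy_comp_val_le1 f g s).

(* Main.v *)
Require Import Defs.
From mathcomp Require Import all_boot all_order all_algebra.
From mathcomp Require Import boolp classical_sets reals.
From mathcomp Require Import interval_inference.

(** Meet with a constant commutes with suprema in a chain, so the product
    collapses to [(f o g)(s) = min (sup f) (g s)] ([fuzzy_compE]): left
    multiplication by [f] only truncates [g] at the height [sup f].  Every claim
    is then read off from the heights.

    Taking suprema once more, [sup (f o g) = min (sup f) (sup g)]
    ([fuzzy_sup_comp]): the height is a homomorphism onto a semilattice, so its
    kernel is a semilattice congruence and contains [eta].  Conversely, truncating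
    [g] at a height at least [sup g] does nothing ([fuzzy_comp_absorb]), so two
    fuzzy subsets [f], [g] of equal height satisfy [f o g = g] and [g o f = f];
    any semilattice congruence identifies [f o g] with [g o f], hence [g] with
    [f].  Thus [eta] is exactly equality of heights, and the same absorption makes
    each class right zero. *)

Set Implicit Arguments.
Unset Strict Implicit.
Unset Printing Implicit Defensive.
Import Order.TTheory GRing.Theory Num.Theory.
Local Open Scope classical_set_scope.
Local Open Scope ring_scope.

Lemma sup_minr (R : realType) (T : Type) (u : T -> R) (c : R) :
  has_sup (range u) ->
  sup (range (fun x => Num.min (u x) c)) = Num.min (sup (range u)) c.
Proof.
move=> [[_ [x0 _ _]] ub]; apply/eqP; rewrite eq_le; apply/andP; split.
  apply: ge_sup; first by exists (Num.min (u x0) c), x0.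
  move=> _ [x _ <-]; rewrite le_min [X in _ && X]ge_min lexx orbT andbT.
  by rewrite ge_min ub_le_sup //; exists x.
have ubm : has_ubound (range (fun x => Num.min (u x) c)).
  by exists c => _ [x _ <-]; rewrite ge_min lexx orbT.
(* Either some value of [u] is at least [c], and then [c] is attained, or
   truncation at [c] leaves [u] unchanged. *)
have [[x cx]|nc] := pselect (exists x, c <= u x).
  apply: (@le_trans _ _ c); first by rewrite ge_min lexx orbT.
  by apply: ub_le_sup => //; exists x => //; rewrite min_r.
rewrite ge_min; apply/orP; left; apply: ge_sup; first by exists (u x0), x0.
move=> _ [x _ <-]; apply: ub_le_sup => //; exists x => //; rewrite min_l //.
by rewrite leNgt; apply/negP => /ltW cx; apply: nc; exists x.
Qed.

Section FuzzySubsets.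
Variables (R : realType) (S : Type).
Hypothesis hS : inhabited S.
Implicit Types f g h : fuzzy R S.

Lemma fuzzy_ext f g : (forall s, (f s)%:num = (g s)%:num :> R) -> f = g.
Proof. by move=> fg; apply/funext => s; apply/val_inj/fg. Qed.

Lemma fuzzy_has_sup f : has_sup (range (fun x => (f x)%:num : R)).
Proof.
case: hS => x0; split; first by exists (f x0)%:num, x0.
by exists 1 => _ [x _ <-]; rewrite le1.
Qed.

Lemma le_fuzzy_sup f s : (f s)%:num <= fuzzy_sup f.
Proof. by apply: ub_le_sup; [case: (fuzzy_has_sup f)|exists s]. Qed.

Lemma fuzzy_compE f g s :
  (fuzzy_comp f g s)%:num = Num.min (fuzzy_sup f) (g s)%:num.
Proof. exact: (sup_minr _ (fuzzy_has_sup f)). Qed.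

Lemma fuzzy_sup_comp f g :
  fuzzy_sup (fuzzy_comp f g) = Num.min (fuzzy_sup f) (fuzzy_sup g).
Proof.
rewrite [RHS]minC -(sup_minr _ (fuzzy_has_sup g)).
apply: (congr1 (fun u : S -> R => sup (range u))).
by apply/funext => s; rewrite fuzzy_compE minC.
Qed.

(** Left multiplication by a taller fuzzy subset truncates above every value. *)
Lemma fuzzy_comp_absorb f g : fuzzy_sup g <= fuzzy_sup f -> fuzzy_comp f g = g.
Proof.
move=> gf; apply: fuzzy_ext => s.
by rewrite fuzzy_compE min_r // (le_trans (le_fuzzy_sup g s) gf).
Qed.

Lemma fuzzy_compA : associative (@fuzzy_comp R S).
Proof.
by move=> f g h; apply: fuzzy_ext => s; rewrite !fuzzy_compE fuzzy_sup_comp minA.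
Qed.

Lemma fuzzy_right_regular_band : right_regular_band (@fuzzy_comp R S).
Proof.
split; first by split; [exact: fuzzy_compA|move=> f; exact: fuzzy_comp_absorb].
(* The factor [g] can only lower [f], so truncating once more at the height of
   [f] changes nothing. *)
move=> f g; rewrite -fuzzy_compA; apply: fuzzy_comp_absorb.
by rewrite fuzzy_sup_comp ge_min lexx orbT.
Qed.

(** The kernel of the height, a homomorphism into the semilattice of reals
    under [min]. *)
Lemma fuzzy_sup_semilattice_congruence :
  semilattice_congruence (@fuzzy_comp R S)
    (fun f g => fuzzy_sup f = fuzzy_sup g).
Proof.
have cg : congruence (@fuzzy_comp R S) (fun f g => fuzzy_sup f = fuzzy_sup g).
  split=> // [f g h -> //|f f' g g' ff' gg'].
  by rewrite !fuzzy_sup_comp ff' gg'.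
split=> //; apply/(semilattice_congruenceP cg).
split=> [f g h|f|f g]; rewrite !fuzzy_sup_comp.
- by rewrite minA.
- by rewrite minxx.
- by rewrite minC.
Qed.

Lemma least_semilattice_congruence_fuzzy_sup
    (eta : fuzzy R S -> fuzzy R S -> Prop) f g :
  least_semilattice_congruence (@fuzzy_comp R S) eta ->
  eta f g <-> fuzzy_sup f = fuzzy_sup g.
Proof.
move=> [[cg sl] least]; split=> [|fg].
  exact: (least _ fuzzy_sup_semilattice_congruence).
have [_ _ /(_ g f)] := (semilattice_congruenceP cg).1 sl.
by rewrite !fuzzy_comp_absorb ?fg.
Qed.

End FuzzySubsets.

Theorem theorem2p6 (R : realType) (S : Type) (hS : inhabited S) :
  right_regular_band (@fuzzy_comp R S) /\
  forall eta : fuzzy R S -> fuzzy R S -> Prop,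
    least_semilattice_congruence (@fuzzy_comp R S) eta ->
    (forall C : set (fuzzy R S), is_class eta C ->
       exists hC : op_closed (@fuzzy_comp R S) C,
         right_zero_semigroup (sub_op hC)) /\
    (forall f g : fuzzy R S, eta f g <-> fuzzy_sup f = fuzzy_sup g).
Proof.
split; first exact: fuzzy_right_regular_band.
move=> eta eta_least.
have etaE f g := least_semilattice_congruence_fuzzy_sup hS f g eta_least.
split=> [C [h ->{C}]|//].
have absorb f g : eta h f -> eta h g -> fuzzy_comp f g = g.
  by move=> /etaE hf /etaE hg; apply: fuzzy_comp_absorb; rewrite // -hf -hg.
have closed : op_closed (@fuzzy_comp R S) (eta h).
  by move=> f g hf hg; rewrite absorb.
exists closed.
have sub_opr a b : sub_op closed a b = b.
  apply: eq_sig_hprop => [f p q|/=]; first exact: Prop_irrelevance.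
  by apply: absorb; exact: svalP.
by split=> // a b c; rewrite !sub_opr.
Qed.
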